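(* Let $n\ge 4$, $a_1=\cdots=a_{n-1}=2$ and $a_n=\frac32$. Then the ellipsoid $\Sigma\subset\mathbb{R}^{n+1}$ parameterized by $$\sigma(x_1,\dots,x_n)=\left(x_1,\dots,x_n,\sqrt{1-(a_1x_1^2+\cdots+a_nx_n^2)}\right),\qquad a_1x_1^2+\cdots+a_nx_n^2<1,$$ with the Riemannian metric induced by the Euclidean metric of $\mathbb{R}^{n+1}$, is not conformally flat.
   Context: For $n\ge4$, a hypersurface $\Sigma\subset\mathbb{R}^{n+1}$ with induced metric given in local coordinates by $G(x)=(g_{ij})$, with inverse $(g^{ij})$, is called conformally flat if the Weyl conformal curvature tensor vanishes identically, $W_{ijkl}=0$ for all $i,j,k,l$. Here (summation convention) $R_{ijkl}$ are the components $R_m(\partial_i,\partial_j,\partial_k,\partial_l)$ of the Riemann curvature tensor $R_m(X,Y,Z,W)=\langle\nabla_X\nabla_YZ-\nabla_Y\nabla_XZ-\nabla_{[X,Y]}Z,W\rangle$, $R_{ij}=g^{\mu\nu}R_{\mu ij\nu}$, $R=g^{ij}R_{ij}$, and $$W_{ijkl}=R_{ijkl}+\frac{1}{n-2}(g_{ki}R_{jl}-g_{il}R_{jk}+g_{jl}R_{ik}-g_{jk}R_{il})+\frac{1}{(n-1)(n-2)}(g_{il}g_{jk}-g_{ki}g_{jl})R.$$ *)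

(* Defs.v *)
From mathcomp Require Import all_boot all_order all_algebra.
From mathcomp Require Import all_classical all_reals all_analysis.
Set Implicit Arguments. Unset Strict Implicit. Unset Printing Implicit Defensive.
Import Order.TTheory GRing.Theory Num.Theory.
Import numFieldNormedType.Exports.
Local Open Scope classical_set_scope.
Local Open Scope ring_scope.

(* Tensor calculus in a single chart: points and tangent vectors are row
   vectors, a vector field is given by its components in the coordinate frame
   ['e_i] (i.e. d/dx_i), and a metric is the field x |-> (g_ij(x)) of its Gram
   matrices.  The operations below are total; they have their intended meaning
   where the maps involved are smooth and the metric is invertible. *)

Section ChartGeometry.
Variables (R : realType) (n : nat).

Definition partial (i : 'I_n) (f : 'rV[R]_n -> R) (x : 'rV[R]_n) : R :=
  'D_('e_i) f x.

Definition euclid_dot (m : nat) (u v : 'rV[R]_m) : R :=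
  \sum_(k < m) u 0 k * v 0 k.

Definition induced_metric (m : nat) (sigma : 'rV[R]_n -> 'rV[R]_m)
    (x : 'rV[R]_n) : 'M[R]_n :=
  \matrix_(i < n, j < n) euclid_dot ('D_('e_i) sigma x) ('D_('e_j) sigma x).

Section Curvature.
Variable g : 'rV[R]_n -> 'M[R]_n.

Definition metric_inv (x : 'rV[R]_n) : 'M[R]_n := invmx (g x).

Definition metric_dot (x : 'rV[R]_n) (u v : 'rV[R]_n) : R :=
  \sum_(i < n) \sum_(j < n) g x i j * u 0 i * v 0 j.

(* Gamma^k_ij of the Levi-Civita connection *)
Definition christoffel (k i j : 'I_n) (x : 'rV[R]_n) : R :=
  2^-1 * \sum_(l < n) metric_inv x k l *
    (partial i (fun y => g y j l) x + partial j (fun y => g y i l) x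
     - partial l (fun y => g y i j) x).

Definition nabla (X Y : 'rV[R]_n -> 'rV[R]_n) (x : 'rV[R]_n) : 'rV[R]_n :=
  \row_(k < n)
    (\sum_(i < n) X x 0 i * partial i (fun y => Y y 0 k) x
     + \sum_(i < n) \sum_(j < n) christoffel k i j x * X x 0 i * Y x 0 j).

Definition lie_bracket (X Y : 'rV[R]_n -> 'rV[R]_n) (x : 'rV[R]_n) :
    'rV[R]_n :=
  \row_(k < n)
    \sum_(i < n) (X x 0 i * partial i (fun y => Y y 0 k) x
                  - Y x 0 i * partial i (fun y => X y 0 k) x).

Definition riemann (X Y Z W : 'rV[R]_n -> 'rV[R]_n) (x : 'rV[R]_n) : R :=
  metric_dot x
    (nabla X (nabla Y Z) x - nabla Y (nabla X Z) x
     - nabla (lie_bracket X Y) Z x)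
    (W x).

Definition coord_field (i : 'I_n) : 'rV[R]_n -> 'rV[R]_n := fun=> 'e_i.

Definition riemann_comp (i j k l : 'I_n) (x : 'rV[R]_n) : R :=
  riemann (coord_field i) (coord_field j) (coord_field k) (coord_field l) x.

Definition ricci (i j : 'I_n) (x : 'rV[R]_n) : R :=
  \sum_(mu < n) \sum_(nu < n) metric_inv x mu nu * riemann_comp mu i j nu x.

Definition scalar_curv (x : 'rV[R]_n) : R :=
  \sum_(i < n) \sum_(j < n) metric_inv x i j * ricci i j x.

Definition weyl (i j k l : 'I_n) (x : 'rV[R]_n) : R :=
  riemann_comp i j k l x
  + (n%:R - 2)^-1 *
      (g x k i * ricci j l x - g x i l * ricci j k x
       + g x j l * ricci i k x - g x j k * ricci i l x)
  + ((n%:R - 1) * (n%:R - 2))^-1 *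
      (g x i l * g x j k - g x k i * g x j l) * scalar_curv x.

End Curvature.

(* The hypersurface parameterized by sigma on D is conformally flat (its Weyl
   tensor vanishes at every point of D); this is
   the usual notion for 4 <= n only. *)
Definition conformally_flat (D : set 'rV[R]_n)
    (sigma : 'rV[R]_n -> 'rV[R]_(n + 1)) : Prop :=
  forall x, D x ->
    forall i j k l : 'I_n, weyl (induced_metric sigma) i j k l x = 0.

Definition ellipsoid_domain (a : 'I_n -> R) : set 'rV[R]_n :=
  [set x | \sum_(i < n) a i * x 0 i ^+ 2 < 1].

Definition ellipsoid_param (a : 'I_n -> R) (x : 'rV[R]_n) : 'rV[R]_(n + 1) :=
  row_mx x (Num.sqrt (1 - \sum_(i < n) a i * x 0 i ^+ 2))%:M.

End ChartGeometry.

(* Main.v *)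
Require Import Defs.
From mathcomp Require Import all_boot all_order all_algebra.
From mathcomp Require Import all_classical all_reals all_analysis.
From mathcomp Require Import ring lra zify.
Import Order.TTheory GRing.Theory Num.Theory.
Import numFieldNormedType.Exports.
Local Open Scope classical_set_scope.
Local Open Scope ring_scope.

(** The ellipsoid is the graph of the square root of
    [Q = 1 - \sum_i a_i x_i^2].  Put [p_i = a_i x_i]: then [(p, sqrt Q)] is
    normal to it, with squared norm [S = Q + \sum_i p_i^2], the induced metric
    is [delta_ij + p_i p_j / Q] with inverse [delta_ij - p_i p_j / S], and with
    [h_ij = a_i delta_ij + p_i p_j / Q] the Christoffel symbols are
    [Gamma^k_ij = p_k h_ij / S].  All of these are rational functions of [x].

    A hypersurface of dimension at least 4 is conformally flat only if all its
    principal curvatures but one agree.  At the point [x_o = 1 / 2] of the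
    first axis (all other [x_i] zero) the principal curvatures have the
    pattern (c, b, ..., b, d) with [b], [c], [d] distinct: [c] belongs to the
    direction of [x_o], and [d] to that of the last coordinate [x_l], whose
    coefficient is [3 / 2].

    To see this on the Weyl tensor without computing any trace, let [K_ij] be
    the sectional curvature of the coordinate plane of [x_i] and [x_j] at that
    point, where the metric is diagonal.  The Weyl component [W_ijji], divided
    by [g_ii g_jj], is [K_ij] minus a sum of a term in [i] and a term in [j],
    plus a constant.  Hence a vanishing Weyl tensor forces
    [K_po + K_lq = K_lo + K_pq] for distinct indices [o], [p], [q], [l]; these
    exist because the dimension is at least 4.  By [ellipsoid_riemannE] the two
    sides are [16 / 9 + 2] and [4 / 3 + 8 / 3], which differ. *)

(** * Curvature in coordinates *)

Section CoordinateCurvature.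
Set Implicit Arguments. Unset Strict Implicit.
Context {R : realType} {n : nat}.
Variable g : 'rV[R]_n -> 'M[R]_n.
Implicit Types (x : 'rV[R]_n) (i j k l m : 'I_n) (Y : 'rV[R]_n -> 'rV[R]_n).

Lemma sum_coordl (F : 'I_n -> R) j :
  \sum_(i < n) ('e_j : 'rV[R]_n) 0 i * F i = F j.
Proof.
rewrite (bigD1 j) //= big1 => [|i ij]; last first.
  by rewrite mxE eqxx /= (negbTE ij) mul0r.
by rewrite addr0 mxE !eqxx mul1r.
Qed.

Lemma sum_coordr (F : 'I_n -> R) j :
  \sum_(i < n) F i * ('e_j : 'rV[R]_n) 0 i = F j.
Proof. by under eq_bigr do rewrite mulrC; exact: sum_coordl. Qed.

Lemma nabla_coord k Y x m :
  nabla g (coord_field k) Y x 0 m =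
  partial k (fun y => Y y 0 m) x + \sum_(q < n) christoffel g m k q x * Y x 0 q.
Proof.
rewrite mxE /coord_field sum_coordl exchange_big /=; congr (_ + _).
by apply: eq_bigr => q _; rewrite -mulr_suml sum_coordr.
Qed.

Lemma nabla_coord_coord j k x m :
  nabla g (coord_field j) (coord_field k) x 0 m = christoffel g m j k x.
Proof.
rewrite nabla_coord /coord_field sum_coordr /partial.
by rewrite -[X in 'D__ X _]/(cst _) derive_cst add0r.
Qed.

Lemma lie_bracket_coord i j x :
  lie_bracket (@coord_field R n i) (coord_field j) x = 0.
Proof.
apply/rowP => m; rewrite [RHS]mxE mxE big1 // => p _.
rewrite /partial /coord_field.
by rewrite -![X in 'D__ X _]/(cst _) !derive_cst !mulr0 subrr.
Qed.

(** The classical expression of the Riemann tensor by Christoffel symbols; no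
    regularity of [g] is needed, since only constant fields are differentiated
    before the Christoffel symbols themselves. *)
Lemma riemann_compE i j k l x :
  riemann_comp g i j k l x =
  \sum_(m < n) g x m l *
    (partial i (christoffel g m j k) x - partial j (christoffel g m i k) x
     + \sum_(q < n) (christoffel g m i q x * christoffel g q j k x
                     - christoffel g m j q x * christoffel g q i k x)).
Proof.
rewrite /riemann_comp /riemann /metric_dot; apply: eq_bigr => m _.
rewrite [coord_field l x]/coord_field sum_coordr; congr (_ * _).
have L : nabla g (lie_bracket (coord_field i) (coord_field j))
    (coord_field k) x 0 m = 0.
  rewrite mxE lie_bracket_coord.
  rewrite big1 => [|p _]; last by rewrite mxE mul0r.
  rewrite big1 ?addr0 // => p _; rewrite big1 // => q _.
  by rewrite mxE mulr0 mul0r.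
have NN p q :
   nabla g (coord_field p) (nabla g (coord_field q) (coord_field k)) x 0 m =
   partial p (christoffel g m q k) x
   + \sum_(r < n) christoffel g m p r x * christoffel g r q k x.
  rewrite nabla_coord; congr (_ + _).
    by congr (partial p _ x); apply/funext => y; exact: nabla_coord_coord.
  by apply: eq_bigr => r _; rewrite nabla_coord_coord.
have subE (u v w : 'rV[R]_n) : (u - v - w) 0 m = u 0 m - v 0 m - w 0 m.
  by rewrite !mxE.
by rewrite subE L !NN sumrB subr0 opprD addrACA.
Qed.

End CoordinateCurvature.

(** * Directional derivatives of real-valued functions *)

Section Calculus.
Set Implicit Arguments. Unset Strict Implicit.
Context {R : realType} {V : normedModType R}.
Implicit Types (f g : V -> R) (x v : V).

(* The following rules restate those for sums, products and inverses of
   functions for pointwise expressions, with values in the field. *)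

Lemma is_derive_addf f g x v df dg : is_derive x v f df ->
  is_derive x v g dg -> is_derive x v (fun y => f y + g y) (df + dg).
Proof. by move=> Hf Hg; exact: (is_deriveD Hf Hg). Qed.

Lemma is_derive_mulf f g x v df dg : is_derive x v f df ->
  is_derive x v g dg ->
  is_derive x v (fun y => f y * g y) (df * g x + f x * dg).
Proof.
move=> Hf Hg.
have H : is_derive x v (fun y => f y * g y) _ := is_deriveM Hf Hg.
apply: is_derive_eq H _.
by rewrite /GRing.scale /= addrC mulrC.
Qed.

Lemma is_derive_invf f x v df : f x != 0 -> is_derive x v f df ->
  is_derive x v (fun y => (f y)^-1) (- df / f x ^+ 2).
Proof.
move=> fx [Df <-]; apply: DeriveDef; first exact: derivableV.
by rewrite deriveV // /GRing.scale /= mulrC mulrN mulNr.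
Qed.

Lemma is_derive_sqrtf f x v df : 0 < f x -> is_derive x v f df ->
  is_derive x v (fun y => Num.sqrt (f y)) (df / (2 * Num.sqrt (f x))).
Proof.
move=> fx [Df <-].
(* Reduction to one variable, along the line through x directed by v. *)
have D1E (g : V -> R) : 'D_v g x = 'D_1 (fun t : R => g (t *: v + x)) 0.
  rewrite /derive; set F := fun _ => _; set G := fun _ => _.
  suff -> : F = G by [].
  by apply/funext => t; rewrite /F /G /= addr0 scale0r add0r [_%:A]mulr1.
pose h (t : R) := f (t *: v + x).
have h0 : h 0 = f x by rewrite /h scale0r add0r.
have Dh : is_derive (0 : R) 1 h ('D_v f x).
  by rewrite D1E; apply/derivableP; exact: (derivable1P _ _ _).1 Df.
have Hs : is_derive (h 0) 1 Num.sqrt (2 * Num.sqrt (h 0))^-1.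
  by apply: is_derive1_sqrt; rewrite h0.
have [D1 E1] := is_derive1_comp Hs Dh.
apply: DeriveDef; first exact: (derivable1P _ _ _).2 D1.
by rewrite mulrC -h0 [LHS]D1E.
Qed.

Lemma is_derive_sumf n (F : 'I_n -> V -> R) x v (dF : 'I_n -> R) :
  (forall i, is_derive x v (F i) (dF i)) ->
  is_derive x v (fun y => \sum_(i < n) F i y) (\sum_(i < n) dF i).
Proof.
move=> H; have := is_derive_sum H.
suff -> : (\sum_(i < n) F i) = (fun y => \sum_(i < n) F i y) by [].
by apply/funext => y; rewrite fct_sumE.
Qed.

End Calculus.

(** * The metric and the connection of the ellipsoid *)

Section Quadric.
Set Implicit Arguments. Unset Strict Implicit.
Context {R : realType} {n : nat}.
Variable a : 'I_n -> R.
Implicit Types (x y v : 'rV[R]_n) (i j k l : 'I_n).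

Lemma is_derive_coord x v k : is_derive x v (fun y : 'rV[R]_n => y 0 k) (v 0 k).
Proof.
have [D E] := is_derive_id x v.
apply: DeriveDef; first exact: ((derivable_mxP id x v).1 D).
by have := E; rewrite (derive_mx D) => /matrixP/(_ 0 k); rewrite mxE.
Qed.

(** The square of the last ambient coordinate of the point of the ellipsoid
    above [x]. *)
Definition height2 x : R := 1 - \sum_(i < n) a i * x 0 i ^+ 2.

(** The squared Euclidean norm of the normal vector [(a_i x_i)_i, sqrt Q], where
    [Q] is [height2 x]. *)
Definition normal2 x : R := height2 x + \sum_(i < n) (a i * x 0 i) ^+ 2.

Lemma is_derive_height2 x v : is_derive x v height2
  (- 2 * \sum_(i < n) a i * x 0 i * v 0 i).
Proof.
have D : forall i, is_derive x v (fun y : 'rV[R]_n => - a i * (y 0 i * y 0 i))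
    (- 2 * (a i * x 0 i * v 0 i)).
  move=> i; have C := is_derive_coord x v i.
  have := is_derive_mulf (is_derive_cst (- a i) x v)
    (is_derive_mulf C C).
  by move=> H; apply: is_derive_eq H _; rewrite /cst; ring.
have := is_derive_addf (is_derive_cst (1 : R) x v)
  (is_derive_sumf D).
have -> : (fun y : 'rV[R]_n => cst 1 y + \sum_(i < n) - a i * (y 0 i * y 0 i))
   = height2.
  apply/funext => y; rewrite /height2 /cst -sumrN; congr (_ + _).
  by apply: eq_bigr => i _; rewrite mulNr expr2.
by move=> H; apply: is_derive_eq H _; rewrite add0r mulr_sumr.
Qed.

Lemma is_derive_normal2 x v : exists d, is_derive x v normal2 d.
Proof.
have D : forall i, is_derive x v (fun y : 'rV[R]_n => (a i * y 0 i) ^+ 2)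
    (2 * a i ^+ 2 * x 0 i * v 0 i).
  move=> i; have C := is_derive_mulf (is_derive_cst (a i) x v)
    (is_derive_coord x v i).
  have := is_derive_mulf C C.
  have -> : (fun y : 'rV[R]_n => (a i * y 0 i) ^+ 2) =
    (fun y => cst (a i) y * y 0 i * (cst (a i) y * y 0 i)).
    by apply/funext => y; rewrite expr2.
  by move=> H; apply: is_derive_eq H _; rewrite /cst; ring.
eexists; exact: is_derive_addf (is_derive_height2 x v)
  (is_derive_sumf D).
Qed.

Lemma continuous_height2 : continuous height2.
Proof.
move=> x; apply: (cvgB (F := nbhs x)); first exact: cvg_cst.
apply: (cvg_big (op := +%R)) => [|i _]; first exact: add_continuous.
apply: (cvgM (F := nbhs x)); first exact: cvg_cst.
under eq_fun do rewrite expr2.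
by apply: (cvgM (F := nbhs x)); exact: coord_continuous.
Qed.

(** The domain of the parameterization is open, so that formulas valid on it
    can be differentiated. *)
Lemma near_height2_gt0 x : 0 < height2 x -> \near x, 0 < height2 x.
Proof.
by move=> x0; exact: (cvgr_gt _ (@continuous_height2 x)).
Qed.

Lemma derive_ellipsoid_param x v : 0 < height2 x ->
  'D_v (ellipsoid_param a) x =
  row_mx v (- (\sum_(i < n) a i * x 0 i * v 0 i) / Num.sqrt (height2 x))%:M.
Proof.
move=> x0; set D := row_mx _ _.
have C : forall (r : 'I_1) (c : 'I_(n + 1)),
    is_derive x v (fun y => ellipsoid_param a y r c) (D r c).
  move=> r c; rewrite (ord1 r) /ellipsoid_param.
  case: (fintype.splitP c) => [k ck | k ck].
    have -> : c = lshift 1 k by apply: val_inj.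
    under eq_fun do rewrite row_mxEl.
    by rewrite row_mxEl; exact: is_derive_coord.
  have -> : c = rshift n 0 by apply: val_inj; rewrite /= ck (ord1 k).
  under eq_fun do rewrite row_mxEr mxE eqxx mulr1n.
  rewrite /D row_mxEr mxE eqxx mulr1n.
  have H := is_derive_sqrtf x0 (is_derive_height2 x v).
  apply: is_derive_eq H _; field.
  by rewrite gt_eqF ?sqrtr_gt0.
rewrite derive_mx; last by apply/derivable_mxP => r c; have [] := C r c.
by apply/matrixP => r c; rewrite mxE; have [] := C r c.
Qed.

Lemma ellipsoid_metricE x i j : 0 < height2 x ->
  induced_metric (ellipsoid_param a) x i j =
  (i == j)%:R + a i * x 0 i * (a j * x 0 j) / height2 x.
Proof.
move=> x0; rewrite mxE /euclid_dot !derive_ellipsoid_param // big_split_ord /=.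
rewrite big_ord1 !row_mxEr !mxE eqxx !mulr1n.
under eq_bigr do rewrite !row_mxEl.
rewrite !sum_coordr mxE eqxx /= eq_sym; congr (_ + _).
rewrite -[in RHS](sqr_sqrtr (ltW x0)); field.
by rewrite gt_eqF ?sqrtr_gt0.
Qed.

(** The first [n] components of the normal vector of which [normal2] is the
    squared norm. *)
Definition conormal x i : R := a i * x 0 i.

(** The Hessian of the height function [sqrt Q], multiplied by [- sqrt Q] to
    make it rational; it is proportional to the second fundamental form. *)
Definition hess x i j : R :=
  a i * (i == j)%:R + conormal x i * conormal x j / height2 x.

Lemma sum_delta (F : 'I_n -> R) j : \sum_(i < n) (j == i)%:R * F i = F j.
Proof.
rewrite (bigD1 j) //= big1 ?addr0 ?eqxx ?mul1r // => i ij.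
by rewrite eq_sym (negbTE ij) mul0r.
Qed.

Lemma normal2_gt0 x : 0 < height2 x -> 0 < normal2 x.
Proof.
by move=> x0; rewrite ltr_wpDr // sumr_ge0 // => i _; exact: sqr_ge0.
Qed.

Lemma is_derive_conormal x k i :
  is_derive x 'e_k (conormal ^~ i) (a i * (i == k)%:R).
Proof.
have H := is_derive_mulf (is_derive_cst (a i) x 'e_k) (is_derive_coord x 'e_k i).
by apply: is_derive_eq H _; rewrite /cst mxE eqxx mul0r add0r.
Qed.

Lemma is_derive_height2_coord x k :
  is_derive x 'e_k height2 (- 2 * conormal x k).
Proof. by have := is_derive_height2 x 'e_k; rewrite sum_coordr. Qed.

Lemma is_derive_quotient x k i j : 0 < height2 x ->
  is_derive x 'e_k (fun y => conormal y i * conormal y j / height2 y)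
   ((a i * (i == k)%:R * conormal x j + a j * (j == k)%:R * conormal x i)
      / height2 x
    + 2 * conormal x i * conormal x j * conormal x k / height2 x ^+ 2).
Proof.
move=> x0; have xn0 : height2 x != 0 by rewrite gt_eqF.
have H := is_derive_mulf
  (is_derive_mulf (is_derive_conormal x k i) (is_derive_conormal x k j))
  (is_derive_invf xn0 (is_derive_height2_coord x k)).
by apply: is_derive_eq H _; field.
Qed.

Lemma partial_ellipsoid_metric x i j k : 0 < height2 x ->
  partial k (fun y => induced_metric (ellipsoid_param a) y i j) x =
  (a i * (i == k)%:R * conormal x j + a j * (j == k)%:R * conormal x i)
      / height2 x
    + 2 * conormal x i * conormal x j * conormal x k / height2 x ^+ 2.
Proof.
move=> x0; pose c : R := (i == j)%:R.
have [_] := is_derive_addf (is_derive_cst c x 'e_k)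
  (is_derive_quotient k i j x0).
rewrite add0r => <-; apply: near_eq_derive; near=> y.
apply: ellipsoid_metricE; near: y; exact: near_height2_gt0.
Unshelve. all: by end_near. Qed.

Lemma ellipsoid_metric_invE x i j : 0 < height2 x ->
  metric_inv (induced_metric (ellipsoid_param a)) x i j =
  (i == j)%:R - conormal x i * conormal x j / normal2 x.
Proof.
move=> x0; have s0 := normal2_gt0 x0.
pose N : 'M[R]_n :=
  \matrix_(i, j) ((i == j)%:R - conormal x i * conormal x j / normal2 x).
suff gN : induced_metric (ellipsoid_param a) x *m N = 1%:M.
  have [gu _] := mulmx1_unit gN.
  by rewrite /metric_inv -[invmx _]mulmx1 -gN mulKmx // mxE.
apply/matrixP => k l; rewrite !mxE.
have E m : induced_metric (ellipsoid_param a) x k m * N m l =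
    (k == m)%:R * ((m == l)%:R - conormal x m * conormal x l / normal2 x)
    + ((l == m)%:R * (conormal x k * conormal x m / height2 x)
    - conormal x k * conormal x l / (height2 x * normal2 x) * conormal x m ^+ 2).
  rewrite ellipsoid_metricE // mxE -/(conormal x k) -/(conormal x m).
  by rewrite [l == m]eq_sym; field; rewrite !gt_eqF.
rewrite (eq_bigr _ (fun m _ => E m)).
rewrite big_split sumrB /= !sum_delta -mulr_sumr.
have -> : \sum_(i < n) conormal x i ^+ 2 = normal2 x - height2 x.
  by rewrite /normal2 addrC addKr.
by field; rewrite !gt_eqF.
Qed.

Lemma ellipsoid_christoffelE x k i j : 0 < height2 x ->
  christoffel (induced_metric (ellipsoid_param a)) k i j x =
  conormal x k * hess x i j / normal2 x.
Proof.
move=> x0; have s0 := normal2_gt0 x0.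
rewrite /christoffel; set F := (F in \sum_(l < n) F l).
have E l : F l =
    (k == l)%:R * (2 * hess x i j / height2 x * conormal x l)
    - 2 * hess x i j / (height2 x * normal2 x) * conormal x k * conormal x l ^+ 2.
  rewrite /F ellipsoid_metric_invE // !partial_ellipsoid_metric //.
  have H m : a l * (l == m)%:R = a m * (m == l)%:R.
    by rewrite eq_sym; case: eqP => [->//|]; rewrite !mulr0.
  have Hij : a j * (j == i)%:R = a i * (i == j)%:R.
    by rewrite eq_sym; case: eqP => [->//|]; rewrite !mulr0.
  by rewrite !H Hij /hess; field; rewrite !gt_eqF.
rewrite (eq_bigr _ (fun l _ => E l)).
rewrite sumrB /= !sum_delta -mulr_sumr.
have -> : \sum_(i < n) conormal x i ^+ 2 = normal2 x - height2 x.
  by rewrite /normal2 addrC addKr.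
by field; rewrite !gt_eqF.
Qed.

(** As [Gamma^k_ij] has the factor [x_k], where [x_k = 0] only the derivative of
    that factor contributes. *)
Lemma partial_christoffel x l k i j : 0 < height2 x -> x 0 k = 0 ->
  partial l (christoffel (induced_metric (ellipsoid_param a)) k i j) x =
  a k * (k == l)%:R * hess x i j / normal2 x.
Proof.
move=> x0 xk; have s0 := normal2_gt0 x0.
have sn0 : normal2 x != 0 by rewrite gt_eqF.
have [d Hd] := is_derive_normal2 x 'e_l.
have xk0 : conormal x k = 0 by rewrite /conormal xk mulr0.
pose c : R := a i * (i == j)%:R.
have [_ H] := is_derive_mulf (is_derive_mulf (is_derive_conormal x l k)
    (is_derive_addf (is_derive_cst c x 'e_l) (is_derive_quotient l i j x0)))
  (is_derive_invf sn0 Hd).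
have -> : partial l (christoffel (induced_metric (ellipsoid_param a)) k i j) x =
  'D_('e_l) (fun y => conormal y k * (cst c y + conormal y i * conormal y j
     / height2 y) / normal2 y) x.
  apply: near_eq_derive; near=> y.
  apply: ellipsoid_christoffelE; near: y; exact: near_height2_gt0.
by rewrite H xk0 !mul0r !addr0.
Unshelve. all: by end_near. Qed.

(** * Curvature of the ellipsoid *)

(** Where [x_i = 0], all [Gamma^i] vanish, so that the quadratic terms of the
    curvature drop out and [g_im] is [delta_im]. *)
Lemma ellipsoid_riemannE x i j : 0 < height2 x -> i != j -> x 0 i = 0 ->
  riemann_comp (induced_metric (ellipsoid_param a)) i j j i x =
  a i * hess x j j / normal2 x.
Proof.
move=> x0 ij xi.
have xi0 : conormal x i = 0 by rewrite /conormal xi mulr0.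
have giE m : induced_metric (ellipsoid_param a) x m i = (i == m)%:R.
  by rewrite ellipsoid_metricE // -!/(conormal x _) xi0 mulr0 mul0r addr0 eq_sym.
rewrite riemann_compE; under eq_bigr do rewrite giE.
rewrite sum_delta !partial_christoffel // eqxx (negbTE ij) big1 => [|q _].
  by rewrite mulr1 mulr0 !mul0r subr0 addr0.
by rewrite !ellipsoid_christoffelE // xi0 !mul0r subrr.
Qed.

(** The Ricci and scalar curvatures are left unevaluated: they cancel in the
    combination of Weyl components used below. *)
Lemma ellipsoid_weylE x i j : 0 < height2 x -> i != j -> x 0 i = 0 ->
  let g := induced_metric (ellipsoid_param a) in
  weyl g i j j i x =
  a i * hess x j j / normal2 x
  - (n%:R - 2)^-1 * (ricci g j j x + g x j j * ricci g i i x)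
  + ((n%:R - 1) * (n%:R - 2))^-1 * g x j j * scalar_curv g x.
Proof.
move=> x0 ij xi g.
have xi0 : conormal x i = 0 by rewrite /conormal xi mulr0.
have gii : g x i i = 1.
  by rewrite ellipsoid_metricE // -!/(conormal x _) xi0 !mul0r addr0 eqxx.
have gji : g x j i = 0.
  rewrite ellipsoid_metricE // -!/(conormal x _) xi0 mulr0 mul0r addr0.
  by rewrite eq_sym (negbTE ij).
by rewrite /weyl ellipsoid_riemannE // gii gji; ring.
Qed.

End Quadric.

Theorem mainTheorem6 (R : realType) (n : nat) (hn : (4 <= n)%N)
    (a : 'I_n -> R)
    (ha : forall i : 'I_n, (i.+1 < n)%N -> a i = 2)
    (ha_last : forall i : 'I_n, i.+1 = n -> a i = 3 / 2) :
  ~ conformally_flat (ellipsoid_domain a) (ellipsoid_param a).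
Proof.
have lt0 : (0 < n)%N by case: n hn {a ha ha_last}.
have lt1 : (1 < n)%N by apply: leq_trans hn.
have lt2 : (2 < n)%N by apply: leq_trans hn.
have lt3 : (n.-1 < n)%N by rewrite prednK.
pose o := Ordinal lt0; pose p := Ordinal lt1; pose q := Ordinal lt2.
pose l := Ordinal lt3.
have ao : a o = 2 by apply: ha.
have ap : a p = 2 by apply: ha.
have aq : a q = 2 by apply: ha.
have al : a l = 3 / 2 by apply: ha_last; rewrite /= prednK.
have [po qp] : p != o /\ p != q by [].
have lo : l != o by apply/eqP => /(congr1 val) /=; lia.
have lq : l != q by apply/eqP => /(congr1 val) /=; lia.
pose x : 'rV[R]_n := 2^-1 *: 'e_o.
have xE i : x 0 i = 2^-1 * ('e_o : 'rV[R]_n) 0 i by rewrite mxE.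
have x_o : x 0 o = 2^-1 by rewrite xE mxE !eqxx mulr1.
have xN i : i != o -> x 0 i = 0.
  by move=> io; rewrite xE mxE (negbTE io) andbF mulr0.
have sumo (F : 'I_n -> R) : (forall i, i != o -> F i = 0) ->
    \sum_(i < n) F i = F o.
  by move=> F0; rewrite (bigD1 o) //= big1 ?addr0.
have hx : height2 a x = 2^-1.
  rewrite /height2 sumo ?x_o ?ao; first by field.
  by move=> i io; rewrite xN // expr0n mulr0.
have sx : normal2 a x = 3 / 2.
  rewrite /normal2 hx sumo ?x_o ?ao; first by field.
  by move=> i io; rewrite xN // mulr0 expr0n.
have x0 : 0 < height2 a x by rewrite hx invr_gt0.
have hess_o : hess a x o o = 4.
  by rewrite /hess /conormal eqxx mulr1 hx x_o ao; field.
have hess_q : hess a x q q = 2.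
  by rewrite /hess /conormal eqxx mulr1 xN // mulr0 !mul0r addr0.
have g_o : induced_metric (ellipsoid_param a) x o o = 3.
  by rewrite ellipsoid_metricE // eqxx mulr1n hx x_o ao; field.
have g_q : induced_metric (ellipsoid_param a) x q q = 1.
  by rewrite ellipsoid_metricE // eqxx xN // mulr0 !mul0r addr0.
move=> /(_ x) flat.
have Dx : ellipsoid_domain a x by rewrite /ellipsoid_domain /= -subr_gt0.
have {}flat := flat Dx.
(* In each component the outer index is not o, so that its coordinate is 0. *)
move: (flat p o o p) (flat l q q l) (flat l o o l) (flat p q q p).
rewrite !ellipsoid_weylE ?xN // g_o g_q hess_o hess_q ap al sx.
set c1 := (n%:R - 2)^-1; set c2 := ((n%:R - 1) * (n%:R - 2))^-1.
set s := scalar_curv _ x.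
set ro := ricci _ o o x; set rp := ricci _ p p x.
set rq := ricci _ q q x; set rl := ricci _ l l x.
move: c1 c2 s ro rp rq rl => c1 c2 s ro rp rq rl E1 E2 E3 E4.
(* E1 / 3 + E2 - E3 / 3 - E4 cancels the Ricci and scalar curvatures and
   leaves - 2 / 9 = 0. *)
lra.
Qed.
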